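(* Let $\mathbb{K}$ be a computable field, $n>1$, $a=\sum_{j=0}^d c_j s^j\in\mathbb{K}[s]^n$ a non-zero row vector of degree $d$, and let $M\in\mathbb{K}[s]^{n\times(n-1)}$ be the output of the $\mu$-Basis Algorithm (described in the context) on input $a$. Then the columns of $M$ form a $\mu$-basis of $a$.
   Context: $\mu$-Basis Algorithm: (1) Form $A\in\mathbb{K}^{(2d+1)\times n(d+1)}$ whose $(i,\,kn+r)$ entry ($1\le i\le 2d+1$, $0\le k\le d$, $1\le r\le n$) is the $r$-th entry of the row vector $c_{i-1-k}$ (zero if $i-1-k\notin\{0,\dots,d\}$). (2) Compute (possibly only partially, on the relevant columns) the reduced row-echelon form $E$ of $A$; let $p=(p_1<p_2<\dots)$ be the list of pivotal column indices and $\tilde q=(\tilde q_1,\dots,\tilde q_{n-1})$ the list of basic non-pivotal indices. Here a column is pivotal if it is the first column and non-zero or is linearly independent of previous columns, otherwise non-pivotal; with $q$ the set of non-pivotal indices, $\tilde q$ consists of the minimal elements of the classes of $q$ modulo $n$. (3) Initialize $M$ as the $n\times(n-1)$ zero matrix; for each $j=1,\dots,n-1$, with $r=\mathrm{rem}(\tilde q_j-1,n)+1$ and $k=\mathrm{quo}(\tilde q_j-1,n)$, add $s^k$ to $M_{r,j}$; then for each $i=1,\dots,|p|$, with $r=\mathrm{rem}(p_i-1,n)+1$, $k=\mathrm{quo}(p_i-1,n)$, and each $j=1,\dots,n-1$, subtract $E_{i,\tilde q_j}s^k$ from $M_{r,j}$. Output $M$. Definitions: $\mathrm{syz}(a)=\{h\in\mathbb{K}[s]^n\mid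 a\,h=0\}$; for non-zero $h\in\mathbb{K}[s]^n$, $LV(h)$ is the vector of coefficients of $s^{\deg h}$ in its entries, $\deg h=\max_i\deg h_i$. A set $u=\{u_1,\dots,u_{n-1}\}\subset\mathbb{K}[s]^n$ is a $\mu$-basis of $a$ if it has exactly $n-1$ elements, $LV(u_1),\dots,LV(u_{n-1})$ are linearly independent over $\mathbb{K}$, and $u$ is a basis of the $\mathbb{K}[s]$-module $\mathrm{syz}(a)$. *)

(* Defs.v *)
From HB Require Import structures.
From mathcomp Require Import all_boot all_order all_algebra.
Set Implicit Arguments. Unset Strict Implicit. Unset Printing Implicit Defensive.
Import Order.TTheory GRing.Theory Num.Theory.
Local Open Scope ring_scope.

Section MuBasis.
Variable K : fieldType.

Definition vdegc n (h : 'cV[{poly K}]_n) : nat := \max_(i < n) (size (h i ord0)).-1.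
Definition vdegr n (a : 'rV[{poly K}]_n) : nat := \max_(i < n) (size (a ord0 i)).-1.

Definition LV n (h : 'cV[{poly K}]_n) : 'cV[K]_n := \col_i (h i ord0)`_(vdegc h).

Definition in_syz n (a : 'rV[{poly K}]_n) (h : 'cV[{poly K}]_n) : Prop :=
  a *m h = 0.

(* The columns u_1..u_{n-1} of M form a mu-basis of a:
   - they are n-1 elements (the family of columns of M is injective),
   - LV(u_1),...,LV(u_{n-1}) are linearly independent over K,
   - they form a basis of the K[s]-module syz(a): they lie in syz(a),
     generate it, and are K[s]-linearly independent. *)
Definition mu_basis n (a : 'rV[{poly K}]_n) (M : 'M[{poly K}]_(n, n.-1)) : Prop :=
  [/\ injective (fun j : 'I_n.-1 => col j M),
      row_free (\matrix_(j < n.-1, i < n) LV (col j M) i 0),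
      (forall j : 'I_n.-1, in_syz a (col j M)),
      (forall h : 'cV[{poly K}]_n, in_syz a h ->
          exists w : 'cV[{poly K}]_n.-1, h = M *m w)
    & (forall w : 'cV[{poly K}]_n.-1, M *m w = 0 -> w = 0)].

Definition is_lead m N (E : 'M[K]_(m, N)) (i : 'I_m) (j : 'I_N) : Prop :=
  E i j != 0 /\ (forall j' : 'I_N, (j' < j)%N -> E i j' = 0).

Definition is_rref m N (E : 'M[K]_(m, N)) : Prop :=
  [/\
      (forall i1 i2 : 'I_m, (i1 < i2)%N -> row i1 E = 0 -> row i2 E = 0),
      (forall (i1 i2 : 'I_m) (j1 j2 : 'I_N), (i1 < i2)%N ->
          is_lead E i1 j1 -> is_lead E i2 j2 -> (j1 < j2)%N)
    &
      (forall (i : 'I_m) (j : 'I_N), is_lead E i j ->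
          E i j = 1 /\ forall i' : 'I_m, i' != i -> E i' j = 0)].

Definition rref_of m N (A E : 'M[K]_(m, N)) : Prop :=
  is_rref E /\ exists P : 'M[K]_m, P \in unitmx /\ E = P *m A.

(* A 1-based column index kn+r (1<=r<=n) corresponds to the 0-based index
   c = kn + (r-1), so k = c %/ n and r-1 = c %% n; the 1-based row index i
   corresponds to the 0-based row i-1. *)

Definition mxnat (R : nmodType) m N (E : 'M[R]_(m, N)) (i j : nat) : R :=
  match (insub i : option 'I_m), (insub j : option 'I_N) with
  | Some i', Some j' => E i' j'
  | _, _ => 0
  end.

Definition muA n (a : 'rV[{poly K}]_n) :
    'M[K]_((vdegr a).*2.+1, n * (vdegr a).+1) :=
  \matrix_(i, c) (let k := (c %/ n)%N in
                  if (k <= i)%N && (i - k <= vdegr a)%N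
                  then (mxnat a 0 (c %% n))`_(i - k) else 0).

Definition prevcols m N (A : 'M[K]_(m, N)) (j : nat) : 'M[K]_(m, N) :=
  \matrix_(i, j') if (j' < j)%N then A i j' else 0.

Definition pivotal m N (A : 'M[K]_(m, N)) (j : 'I_N) : bool :=
  ~~ ((col j A)^T <= (prevcols A j)^T)%MS.

Definition pivots m N (A : 'M[K]_(m, N)) : seq nat :=
  [seq val j | j <- enum 'I_N & pivotal A j].

Definition nonpivots m N (A : 'M[K]_(m, N)) : seq nat :=
  [seq val j | j <- enum 'I_N & ~~ pivotal A j].

Definition basic_nonpivots n m N (A : 'M[K]_(m, N)) : seq nat :=
  let q := nonpivots A in
  [seq t <- q | all (fun t' => (t' %% n != t %% n)%N) [seq t' <- q | (t' < t)%N]].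

Definition muM n (a : 'rV[{poly K}]_n)
    (E : 'M[K]_((vdegr a).*2.+1, n * (vdegr a).+1)) : 'M[{poly K}]_(n, n.-1) :=
  let A := muA a in
  let p := pivots A in
  let qt := basic_nonpivots n A in
  \matrix_(r < n, j < n.-1)
    (let t := nth 0%N qt j in
     (if (t %% n == r)%N then 'X^(t %/ n) else 0)
     - \sum_(i < size p)
         (if (nth 0%N p i %% n == r)%N
          then (mxnat E i t)%:P * 'X^(nth 0%N p i %/ n) else 0)).

End MuBasis.

(* Main.v *)
Require Import Defs.
From HB Require Import structures.
From mathcomp Require Import all_boot all_order all_algebra.
Import GRing.Theory.
Local Open Scope ring_scope.

(* Order the monomials s^k e_r of K[s]^n by the position c = k n + r (r counted
   from 0), so that column c of [muA a] holds the coefficients of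
   a s^k e_r, and the non-pivotal columns are exactly the leading positions of
   syzygies of degree at most d.  Let l be the first index with deg a_l = d.  Looking at the top coefficient of a h, no
   syzygy h, of any degree, has its leading position congruent to l mod n,
   while the Koszul syzygies a_l e_i - a_i e_l, i <> l, have leading position
   d n + i.  So each class other than l contains exactly one basic non-pivotal
   index, and the columns of M are syzygies with these leading positions.
   Distinct classes mod n give both independence statements, and minimality of
   the basic indices within their classes lets one reduce any syzygy to 0 by
   induction on its leading position. *)

Set Implicit Arguments.
Unset Strict Implicit.
Unset Printing Implicit Defensive.

(** * Polynomial vectors as coefficient sequences indexed by positions, and leading positions *)

Section PositionCoefficients.
Variables (K : fieldType) (n : nat).
Implicit Types (h u : 'cV[{poly K}]_n.+1) (c t k : nat) (r : 'I_n.+1).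

Definition poscoef h c : K := (h (inord (c %% n.+1)) 0)`_(c %/ n.+1).

Definition lead_pos h c : Prop :=
  poscoef h c != 0 /\ forall c', (c < c')%N -> poscoef h c' = 0.

Lemma poscoef_kr h k r : poscoef h (k * n.+1 + r)%N = (h r 0)`_k.
Proof.
by rewrite /poscoef modnMDl divnMDl // modn_small // divn_small // addn0 inord_val.
Qed.

Lemma poscoefB h u c : poscoef (h - u) c = poscoef h c - poscoef u c.
Proof. by rewrite /poscoef !mxE coefB. Qed.

Lemma poscoefZ (x : K) h c : poscoef (x%:P *: h) c = x * poscoef h c.
Proof. by rewrite /poscoef !mxE coefCM. Qed.

Lemma poscoef_sum (I : finType) (F : I -> 'cV[{poly K}]_n.+1) c :
  poscoef (\sum_i F i) c = \sum_i poscoef (F i) c.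
Proof. by rewrite /poscoef summxE coef_sum. Qed.

Lemma poscoef0 c : poscoef 0 c = 0.
Proof. by rewrite /poscoef mxE coef0. Qed.

Lemma poscoefXn k h c : (k * n.+1 <= c)%N ->
  poscoef ('X^k *: h) c = poscoef h (c - k * n.+1)%N.
Proof.
move=> le_kc; rewrite -{1}(subnKC le_kc) /poscoef modnMDl divnMDl // mxE coefXnM.
by rewrite ltnNge leq_addr /= addKn.
Qed.

Lemma poscoef_inj h : (forall c, poscoef h c = 0) -> h = 0.
Proof.
move=> h0; apply/matrixP=> r j; rewrite ord1 mxE; apply/polyP=> k.
by rewrite coef0 -poscoef_kr.
Qed.

Lemma poscoef_bounded h : exists b, forall c, (b <= c)%N -> poscoef h c = 0.
Proof.
exists ((\max_r size (h r ord0)) * n.+1)%N => c le_bc.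
rewrite /poscoef nth_default //.
apply: (@leq_trans (\max_r size (h r ord0))); last by rewrite leq_divRL.
exact: (leq_bigmax (F := fun r => size (h r ord0))).
Qed.

Lemma lead_pos_inj h c c' : lead_pos h c -> lead_pos h c' -> c = c'.
Proof.
move=> [hc h0] [hc' h0']; case: (ltngtP c c') => // lt.
  by rewrite h0 ?eqxx in hc'.
by rewrite h0' ?eqxx in hc.
Qed.

Lemma lead_pos_coef_gt h c k r : lead_pos h c -> (c < k * n.+1 + r)%N ->
  (h r 0)`_k = 0.
Proof. by move=> [_ h0] lt; rewrite -poscoef_kr h0. Qed.

Lemma lead_pos_size h c r : lead_pos h c -> (size (h r ord0) <= (c %/ n.+1).+1)%N.
Proof.
move=> hc; apply/leq_sizeP=> k lt; apply: (lead_pos_coef_gt hc).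
by apply: leq_trans (leq_addr _ _); rewrite -ltn_divLR.
Qed.

(** Positions compare degrees first, so the last non-zero position lies in an entry of maximal
    degree. *)
Lemma lead_pos_vdegc h c : lead_pos h c -> vdegc h = (c %/ n.+1)%N.
Proof.
move=> hc; apply/eqP; rewrite eqn_leq; apply/andP; split.
  apply/bigmax_leqP=> r _; have := lead_pos_size r hc.
  by case: (size _).
apply: leq_trans (leq_bigmax (F := fun r => (size (h r ord0)).-1) (inord (c %% n.+1))).
case: hc => hc _; rewrite -ltnS; apply: leq_trans (leqSpred _).
rewrite ltnNge; apply/negP=> le; move: hc.
by rewrite /poscoef nth_default ?eqxx.
Qed.

(** Multiplying by s shifts every position by [n.+1], so only the leading coefficient of [w] times
    the coefficient of [u] at [t] reaches the top. The class of [t] modulo [n.+1] is kept. *)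
Lemma lead_posZ (w : {poly K}) u t : w != 0 -> lead_pos u t ->
  lead_pos (w *: u) ((size w).-1 * n.+1 + t).
Proof.
move=> w0 ut; have [utn ut0] := ut; split.
  rewrite /poscoef modnMDl divnMDl // mxE.
  rewrite coefM (bigD1 (inord (size w).-1)) //=.
  rewrite inordK ?ltnS ?leq_addr // addKn big1 ?addr0.
    by rewrite mulf_neq0 // -lead_coefE lead_coef_eq0.
  move=> i ne_i; case: (ltngtP i (size w).-1) => [lt|gt|eqi].
  - rewrite (lead_pos_coef_gt ut) ?mulr0 //.
    move: (nat_of_ord i) lt => k lt.
    apply: (@leq_trans ((t %/ n.+1).+1 * n.+1)); first by rewrite -ltn_divLR.
    apply: leq_trans (leq_addr _ _); rewrite leq_mul2r /=.
    by rewrite -addnBAC ?(ltnW lt) // -{1}[(t %/ n.+1)%N]add0n ltn_add2r subn_gt0.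
  - rewrite nth_default ?mul0r //; move: (nat_of_ord i) gt => k.
    by case: (size w).
  - case/negP: ne_i; apply/eqP/val_inj; rewrite /= inordK ?eqi //.
    by rewrite ltnS leq_addr.
move=> c lt; rewrite /poscoef mxE coefM big1 // => i _.
case: (leqP i (size w).-1) => [le|gt]; last first.
  by rewrite nth_default ?mul0r //; move: gt; case: (size w).
suff -> : (u (inord (c %% n.+1)) 0)`_(c %/ n.+1 - i) = 0 by rewrite mulr0.
have cE := divn_eq c n.+1.
apply: (lead_pos_coef_gt ut); rewrite inordK ?ltn_mod // mulnBl addnC addnBA; last first.
  by rewrite leq_mul2r /= -ltnS ltn_ord.
rewrite addnC -cE ltn_subRL; apply: leq_ltn_trans lt.
by rewrite leq_add2r leq_mul2r le.
Qed.
End PositionCoefficients.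

Lemma mxnatE (R : nmodType) m N (A : 'M[R]_(m, N)) (i : 'I_m) (j : 'I_N) :
  mxnat A i j = A i j.
Proof. by rewrite /mxnat !valK. Qed.

(** * Pivotal columns and reduced row-echelon forms *)

Section Pivots.
Variables (K : fieldType) (m N : nat).
Implicit Types (A E : 'M[K]_(m, N)) (i : 'I_m) (j : 'I_N).

Lemma colsubP A j : reflect
  (exists x : 'I_N -> K, forall i, A i j = \sum_(j' < N | (j' < j)%N) A i j' * x j')
  ((col j A)^T <= (prevcols A j)^T)%MS.
Proof.
apply: (iffP submxP) => [[x Ax]|[x Ax]].
  exists (fun j' => x 0 j') => i; move/matrixP/(_ 0 i): Ax; rewrite !mxE => ->.
  rewrite [RHS]big_mkcond /=; apply: eq_bigr => j' _; rewrite !mxE.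
  by case: ifP => _; rewrite ?mulr0 // mulrC.
exists (\row_j' x j'); apply/matrixP=> k i; rewrite !mxE Ax big_mkcond /=.
apply: eq_bigr => j' _; rewrite !mxE.
by case: ifP => _; rewrite ?mulr0 // mulrC.
Qed.

(** An invertible [P] acts injectively on columns and so preserves their linear relations. *)
Lemma pivotal_mulmx A (P : 'M_m) j : P \in unitmx -> pivotal (P *m A) j = pivotal A j.
Proof.
move=> Pu; rewrite /pivotal.
have -> : prevcols (P *m A) j = P *m prevcols A j.
  apply/matrixP=> i j'; rewrite !mxE; case: ifP => lt.
    by apply: eq_bigr => k _; rewrite !mxE lt.
  by rewrite big1 // => k _; rewrite !mxE lt mulr0.
rewrite [col j _](_ : _ = P *m col j A); last first.
  by apply/matrixP=> i k; rewrite !mxE; apply: eq_bigr => i' _; rewrite mxE.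
by rewrite !trmx_mul submxMfree // row_free_unit unitmx_tr.
Qed.

Lemma mem_pivots A (c : nat) :
  reflect (exists2 j : 'I_N, pivotal A j & c = j) (c \in pivots A).
Proof.
apply: (iffP mapP) => [[j]|[j pj ->]].
  by rewrite mem_filter => /andP[pj _] ->; exists j.
by exists j; rewrite // mem_filter pj mem_enum.
Qed.

Lemma mem_nonpivots A (c : nat) :
  reflect (exists2 j : 'I_N, ~~ pivotal A j & c = j) (c \in nonpivots A).
Proof.
apply: (iffP mapP) => [[j]|[j pj ->]].
  by rewrite mem_filter => /andP[pj _] ->; exists j.
by exists j; rewrite // mem_filter pj mem_enum.
Qed.

Lemma sorted_val_filter_enum (P : pred 'I_N) :
  sorted ltn [seq val j | j <- enum 'I_N & P j].
Proof.
apply: (subseq_sorted ltn_trans _ (iota_ltn_sorted 0 N)).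
by rewrite -val_enum_ord map_subseq // filter_subseq.
Qed.

Lemma rref_lead_exists E i j : E i j != 0 -> exists2 j', is_lead E i j' & (j' <= j)%N.
Proof.
move=> Eij; case: (arg_minnP (P := fun j => E i j != 0) (@nat_of_ord N) Eij) => j' Ej' minj'.
exists j'; last exact: minj'.
split=> // j'' lt; apply/eqP; apply: contraLR lt => ne0.
by rewrite -leqNgt minj'.
Qed.

Lemma is_lead_inj E i j1 j2 : is_lead E i j1 -> is_lead E i j2 -> j1 = j2.
Proof.
move=> [n1 z1] [n2 z2]; apply: val_inj; case: (ltngtP j1 j2) => // lt.
  by rewrite z2 ?eqxx in n1.
by rewrite z1 ?eqxx in n2.
Qed.

Lemma rref_pivotalP E j : is_rref E ->
  reflect (exists i, is_lead E i j) (pivotal E j).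
Proof.
move=> [_ _ E1].
pose isld i j' := (E i j' != 0) && [forall j'' : 'I_N, (j'' < j')%N ==> (E i j'' == 0)].
have isldP i j' : reflect (is_lead E i j') (isld i j').
  apply: (iffP andP) => [[nz /forallP Z]|[nz Z]]; split=> //.
    by move=> j'' lt; apply/eqP; apply: (implyP (Z j'')).
  by apply/forallP=> j''; apply/implyP=> lt; rewrite Z.
apply: (iffP negP) => [npiv|[i ld]]; last first.
  case/colsubP=> x /(_ i); rewrite big1 => [Eij|j' lt]; last first.
    by rewrite ld.2 ?mul0r.
  by case: ld; rewrite Eij eqxx.
case: (pickP (isld^~ j)) => [i /isldP ld|nold]; first by exists i.
case: npiv; apply/colsubP.
(* The columns led by a row are unit vectors, so column [j] combines earlier ones with its own
   entries as coefficients. *)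
exists (fun j' => \sum_(i | isld i j') E i j) => i.
under eq_bigr do rewrite mulr_sumr.
rewrite (exchange_big_dep predT) //= (bigD1 i) //= [X in _ + X]big1 ?addr0; last first.
  move=> i' ne; rewrite big1 // => j' /andP[_ /isldP ld'].
  by rewrite (E1 _ _ ld').2 ?mul0r // eq_sym.
(* Only the column led by row [i] still contributes. If [E i j] is non-zero, this lead exists and
   precedes [j], because no row leads at [j]. *)
have [Eij|Eij] := eqVneq (E i j) 0.
  by rewrite Eij big1 // => j' _; rewrite mulr0.
have [j0 ld0 le0] := rref_lead_exists Eij.
have lt0 : (j0 < j)%N.
  rewrite ltn_neqAle le0 andbT; apply/eqP=> /val_inj e.
  by move: (nold i) => /isldP[]; rewrite -e.
rewrite (bigD1 j0) /=; last by rewrite lt0; apply/isldP.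
rewrite (E1 _ _ ld0).1 mul1r big1 ?addr0 // => j' /andP[/andP[_ /isldP ld']] /eqP[].
exact: is_lead_inj ld' ld0.
Qed.

(* The zero rows of a reduced echelon form come last, so row [i] carries the [i]-th pivot. *)
Lemma rref_pivots E : is_rref E ->
  [/\ (size (pivots E) <= m)%N,
      forall i j, is_lead E i j -> (i < size (pivots E))%N /\ nth 0%N (pivots E) i = j
    & forall i, (i < size (pivots E))%N -> exists2 j, is_lead E i j & nth 0%N (pivots E) i = j].
Proof.
move=> rrE; have [E0 Elt E1] := rrE.
(* [ld k] is the candidate lead of row [k], and [rk] the index of the first zero row; [find] makes
   [rk] equal to [m] when there is none. *)
pose ld k := find (fun c => mxnat E k c != 0) (iota 0 N).
pose rk := find (fun k => [forall j : 'I_N, mxnat E k j == 0]) (iota 0 m).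
have rk_le : (rk <= m)%N by rewrite -[m in (_ <= m)%N](size_iota 0) find_size.
have rkP i : reflect (exists j, E i j != 0) (i < rk)%N.
  apply: (iffP idP) => [lt|[j nz]].
    have := before_find 0%N lt; rewrite nth_iota // add0n => /negbT /forallPn[j].
    by rewrite mxnatE; exists j.
  rewrite ltnNge; apply/negP=> le; case/eqP: nz.
  have lt_m : (rk < m)%N by apply: leq_ltn_trans (ltn_ord i).
  have rk0 : row (Ordinal lt_m) E = 0.
    apply/rowP=> j'; rewrite !mxE -mxnatE /=.
    have : has (fun k => [forall j : 'I_N, mxnat E k j == 0]) (iota 0 m).
      by rewrite has_find size_iota.
    by move/(nth_find 0%N); rewrite -/rk nth_iota // add0n => /forallP/(_ j')/eqP.
  have : row i E = 0.
    have [e|lt] := eqVneq (Ordinal lt_m) i; first by rewrite -e.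
    by apply: (E0 (Ordinal lt_m)) => //; rewrite ltn_neqAle lt.
  by move/rowP/(_ j); rewrite !mxE.
have ldE i j : is_lead E i j -> ld i = j.
  move=> [nz Z]; apply/eqP; rewrite eqn_leq; apply/andP; split.
    rewrite leqNgt; apply/negP=> lt; have := before_find 0%N lt.
    by rewrite nth_iota // add0n mxnatE (negPf nz).
  rewrite leqNgt; apply/negP=> lt.
  have ltN : (ld i < N)%N by apply: ltn_trans (ltn_ord j).
  have : has (fun c => mxnat E i c != 0) (iota 0 N) by rewrite has_find size_iota.
  move/(nth_find 0%N); rewrite -/(ld i) nth_iota // add0n.
  by rewrite (mxnatE _ _ (Ordinal ltN)) Z ?eqxx.
have ldP i : (i < rk)%N -> exists2 j, is_lead E i j & ld i = j.
  case/rkP=> j /rref_lead_exists[j' ld' _]; exists j' => //; exact: ldE.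
(* Both lists are strictly increasing, so it suffices that they have the same members. *)
have pivE : pivots E = mkseq ld rk.
  apply: (irr_sorted_eq ltn_trans ltnn).
  - exact: sorted_val_filter_enum.
  - apply/(sortedP 0%N)=> k; rewrite size_mkseq => lt.
    rewrite !nth_mkseq ?(ltnW lt) //.
    have lm : (k.+1 < m)%N by apply: leq_trans rk_le.
    have [j1 l1 e1] := ldP (Ordinal (ltnW lm)) (ltnW lt).
    have [j2 l2 e2] := ldP (Ordinal lm) lt.
    by rewrite /= in e1 e2; rewrite e1 e2; apply: Elt l1 l2.
  - move=> c; apply/mem_pivots/mapP=> [[j /(rref_pivotalP _ rrE)[i ldij] ->]|[k]].
      exists (val i); last by rewrite (ldE _ _ ldij).
      by rewrite mem_iota add0n /=; apply/rkP; exists j; case: ldij.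
    rewrite mem_iota add0n /= => lt ->; have lm : (k < m)%N by apply: leq_trans rk_le.
    have [j l e] := ldP (Ordinal lm) lt; exists j => //.
    by apply/(rref_pivotalP _ rrE); exists (Ordinal lm).
have ldnth i j : is_lead E i j -> (i < size (pivots E))%N /\ nth 0%N (pivots E) i = j.
  move=> l; have lt : (i < rk)%N by apply/rkP; exists j; case: l.
  by rewrite pivE size_mkseq nth_mkseq //; split=> //; apply: ldE.
split=> //; first by rewrite pivE size_mkseq.
move=> i; rewrite {1}pivE size_mkseq => /ldP[j l e]; exists j => //.
exact: (ldnth _ _ l).2.
Qed.

Lemma rref_of_pivots A E : rref_of A E -> pivots E = pivots A.
Proof.
move=> [_ [P [Pu ->]]]; congr map; apply: eq_filter => j; exact: pivotal_mulmx.
Qed.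

Lemma rref_of_pivot_gt A E k (t : 'I_N) : rref_of A E -> (k < size (pivots A))%N ->
  (t < nth 0%N (pivots A) k)%N -> mxnat E k t = 0.
Proof.
move=> AE; rewrite -(rref_of_pivots AE) => lt; have [le _ ldP] := rref_pivots AE.1.
have lm := leq_trans lt le.
have [j [_ Z] ->] := ldP (Ordinal lm) lt.
by move/Z; rewrite -mxnatE.
Qed.

(** The [k]-th pivot column of [E] is the [k]-th unit vector, so the [k]-th pivot column of
    [A = invmx P *m E] is column [k] of [invmx P]; rows of [E] beyond the pivots are zero. *)
Lemma rref_of_col A E (i : 'I_m) (t : 'I_N) : rref_of A E ->
  A i t = \sum_(k < size (pivots A)) mxnat E k t * mxnat A i (nth 0%N (pivots A) k).
Proof.
move=> AE; have [rrE [P [Pu EA]]] := AE; rewrite -(rref_of_pivots AE).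
have [le leadP ldP] := rref_pivots rrE; have [_ _ E1] := rrE.
have AP : A = invmx P *m E by rewrite EA mulKmx.
pose q k := nth 0%N (pivots E) k.
have AqE (k : 'I_m) : (k < size (pivots E))%N -> mxnat A i (q k) = invmx P i k.
  move=> lt; have [j l e] := ldP k lt.
  rewrite /q e mxnatE AP mxE (bigD1 k) //= (E1 _ _ l).1 mulr1 big1 ?addr0 // => k' ne.
  by rewrite (E1 _ _ l).2 ?mulr0.
transitivity (\sum_(k < m | (k < size (pivots E))%N) mxnat E k t * mxnat A i (q k)).
  transitivity ((invmx P *m E) i t); first by rewrite -AP.
  rewrite mxE [RHS]big_mkcond; apply: eq_bigr => k _.
  case: ifP => [lt|ge]; first by rewrite AqE // mxnatE mulrC.
  suff -> : E k t = 0 by rewrite mulr0.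
  apply/eqP; apply: contraFT ge => /rref_lead_exists[j l _].
  exact: (leadP _ _ l).1.
rewrite -(big_ord_widen_cond _ predT (fun k => mxnat E k t * mxnat A i (q k))) //.
Qed.
End Pivots.

(** * Syzygies as linear relations between the columns of [muA] *)

Section Syzygies.
Variables (K : fieldType) (n : nat) (a : 'rV[{poly K}]_n.+1).
Local Notation d := (vdegr a).
Implicit Types (h : 'cV[{poly K}]_n.+1) (E : 'M[K]_(d.*2.+1, n.+1 * d.+1)).

Lemma size_vdegr r : (size (a ord0 r) <= d.+1)%N.
Proof.
apply: leq_trans (leqSpred _) _; rewrite ltnS.
exact: (leq_bigmax (F := fun r => (size (a ord0 r)).-1)).
Qed.

(** An entry of [muA] at natural-number indices, so that a sum over [c] can be split by quotient and
    remainder. The upper bound on [i - k] disappears, since coefficients beyond degree [d] are 0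
    anyway. *)
Definition muA_entry (i c : nat) : K :=
  if (c %/ n.+1 <= i)%N then (a ord0 (inord (c %% n.+1)))`_(i - c %/ n.+1) else 0.

Lemma muAE i c : muA a i c = muA_entry i c.
Proof.
rewrite mxE /muA_entry; case: leqP => //= _.
rewrite -(inordK (ltn_pmod c (ltn0Sn n))) (mxnatE a ord0) inordK ?ltn_mod //.
case: leqP => // lt; rewrite nth_default //.
exact: leq_trans (size_vdegr _) _.
Qed.

Lemma coef_mulmx_muA h (i : 'I_d.*2.+1) :
  (forall c, (n.+1 * d.+1 <= c)%N -> poscoef h c = 0) ->
  ((a *m h) 0 0)`_i = \sum_c muA a i c * poscoef h c.
Proof.
move=> h0.
under [RHS]eq_bigr do rewrite muAE.
rewrite -(big_mkord predT (fun c => muA_entry i c * poscoef h c)) mulnC big_nat_mul.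
under [RHS]eq_bigr => k _.
  rewrite -{1}[(k * n.+1)%N]add0n big_addn mulSn addnK big_mkord.
  under eq_bigr => r _.
    rewrite addnC poscoef_kr /muA_entry modnMDl divnMDl // modn_small //.
    rewrite divn_small // addn0 inord_val.
  over.
over.
rewrite exchange_big /= mxE coef_sum; apply: eq_bigr => r _.
rewrite coefMr big_mkord.
(* One sum runs over [k <= i], the other over [k <= d]; both are extended to a common range and
   compared termwise. *)
rewrite (big_ord_widen (maxn i.+1 d.+1) (fun k => (a 0 r)`_(i - k) * (h r 0)`_k)) ?leq_maxl //.
rewrite (big_ord_widen (maxn i.+1 d.+1)
  (fun k => (if (k <= i)%N then (a 0 r)`_(i - k) else 0) * (h r 0)`_k)) ?leq_maxr //.
rewrite big_mkcond [RHS]big_mkcond; apply: eq_bigr => k _; rewrite ltnS.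
case: (leqP k i) => _; case: (ltnP k d.+1) => //= lt; last by rewrite mul0r.
suff -> : (h r 0)`_k = 0 by rewrite mulr0.
rewrite -poscoef_kr h0 //; apply: leq_trans (leq_addr _ _).
by rewrite mulnC leq_mul2r.
Qed.

Lemma syz_muA h :
  (forall c, (n.+1 * d.+1 <= c)%N -> poscoef h c = 0) ->
  (forall i, \sum_c muA a i c * poscoef h c = 0) -> a *m h = 0.
Proof.
move=> h0 Ah; apply/matrixP=> i j; rewrite !ord1 [RHS]mxE; apply/polyP=> k.
rewrite coef0; case: (ltnP k d.*2.+1) => [lt|ge].
  by rewrite (coef_mulmx_muA (Ordinal lt)).
(* The rows of [muA] cover the coefficients 0 to 2d; later ones vanish because [a] and [h] have
   degree at most [d]. *)
rewrite mxE coef_sum big1 // => r _; rewrite coefMr big1 // => k' _.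
case: (leqP k' d) => [le|gt].
  rewrite [(a 0 r)`__]nth_default ?mul0r //; apply: leq_trans (size_vdegr _) _.
  by rewrite ltn_subRL; apply: leq_ltn_trans ge; rewrite -addnn leq_add2r.
suff -> : (h r 0)`_k' = 0 by rewrite mulr0.
rewrite -poscoef_kr h0 //; apply: leq_trans (leq_addr _ _).
by rewrite mulnC leq_mul2r.
Qed.

(** [e1] and [e2] only bound the degrees, so the formula also covers entries of lower degree, where
    a factor is 0. *)
Lemma coefM_top (p q : {poly K}) e1 e2 : (size p <= e1.+1)%N -> (size q <= e2.+1)%N ->
  (p * q)`_(e1 + e2) = p`_e1 * q`_e2.
Proof.
move=> sp sq; have lt : (e1 < (e1 + e2).+1)%N by rewrite ltnS leq_addr.
rewrite coefM (bigD1 (Ordinal lt)) //= addKn big1 ?addr0 // => k ne.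
case: (ltngtP k e1) => [lt1|gt|e].
- rewrite [q`__]nth_default ?mulr0 //; apply: leq_trans sq _.
  by rewrite -addnBAC ?(ltnW lt1) // -{1}[e2]add0n ltn_add2r subn_gt0.
- by rewrite nth_default ?mul0r //; apply: leq_trans sp _.
- by case/eqP: ne; apply: val_inj.
Qed.

(** The coefficients of [h] form a relation between columns ending at [c]; dividing by the last one
    expresses column [c] through earlier columns. *)
Lemma syz_nonpivotal h (c : 'I_(n.+1 * d.+1)) :
  a *m h = 0 -> lead_pos h c -> ~~ pivotal (muA a) c.
Proof.
move=> ah [hc h0]; rewrite negbK; apply/colsubP.
exists (fun c' => - poscoef h c' / poscoef h c) => i.
have : \sum_c muA a i c * poscoef h c = 0.
  rewrite -coef_mulmx_muA ?ah ?mxE ?coef0 // => c' le; apply: h0.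
  exact: leq_trans le.
rewrite (bigID (fun c' : 'I__ => (c' < c)%N)) /= [X in _ + X](bigD1 c) ?ltnn //=.
rewrite [X in _ + (_ + X)]big1 ?addr0 => [/eqP|c' /andP[]]; last first.
  rewrite -leqNgt => le ne; rewrite h0 ?mulr0 // ltn_neqAle le andbT.
  by rewrite eq_sym.
rewrite addrC addr_eq0 => /eqP e; apply: (mulIf hc); rewrite e mulr_suml -sumrN.
by apply: eq_bigr => c' _; rewrite mulrA mulfVK // mulrN.
Qed.

Section LeadingClass.
Variable l : 'I_n.+1.
Hypotheses (al : (a 0 l)`_d != 0) (alt : forall r : 'I_n.+1, (r < l)%N -> (a 0 r)`_d = 0).

(** If the class were [l], the coefficient of [a *m h] at [d + c %/ n.+1] would be a product of two
    non-zero scalars: terms before [l] vanish through [a], those after [l] through [h]. *)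
Lemma syz_lead_class h c : a *m h = 0 -> lead_pos h c -> (c %% n.+1)%N != l.
Proof.
move=> ah hc; apply/eqP=> cl; have [hcn h0] := hc.
have := congr1 (fun A : 'M[{poly K}]_1 => (A 0 0)`_(d + c %/ n.+1)) ah.
rewrite /= !mxE coef0 coef_sum.
under eq_bigr do rewrite (coefM_top (size_vdegr _) (lead_pos_size _ hc)).
rewrite (bigD1 l) //= big1 ?addr0 => [/eqP|r ne].
  by rewrite mulf_eq0 (negPf al) /=; move: hcn; rewrite /poscoef cl inord_val => /negPf->.
case: (ltngtP r l) => [lt|gt|/val_inj e]; last by rewrite e eqxx in ne.
  by rewrite alt ?mul0r.
rewrite (lead_pos_coef_gt hc) ?mulr0 //.
by rewrite {1}(divn_eq c n.+1) cl ltn_add2l.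
Qed.

(* The Koszul syzygy [a_l e_i - a_i e_l]. *)
Lemma koszul_nonpivot (i : 'I_n.+1) : i != l -> (d * n.+1 + i)%N \in nonpivots (muA a).
Proof.
move=> il; pose h : 'cV[{poly K}]_n.+1 :=
  \col_r ((if r == i then a 0 l else 0) - (if r == l then a 0 i else 0)).
have lt : (d * n.+1 + i < n.+1 * d.+1)%N.
  by rewrite mulnC mulnS addnC ltn_add2r.
apply/mem_nonpivots; exists (Ordinal lt) => //; apply: (@syz_nonpivotal h).
  apply/matrixP=> x y; rewrite !ord1 !mxE.
  rewrite (eq_bigr (fun r => (if r == i then a 0 r * a 0 l else 0) -
    (if r == l then a 0 r * a 0 i else 0))) => [|r _]; last first.
    by rewrite mxE mulrBr; do 2!case: ifP; rewrite ?mulr0.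
  by rewrite sumrB -!big_mkcond !big_pred1_eq mulrC subrr.
split=> /= [|c lt_c].
  by rewrite poscoef_kr mxE eqxx (negPf il) subr0.
rewrite /poscoef mxE coefB.
have a0 r k : (d < k)%N -> (a 0 r)`_k = 0.
  by move=> ?; rewrite nth_default //; apply: leq_trans (size_vdegr _) _.
have : (d <= c %/ n.+1)%N.
  by rewrite leq_divRL //; apply: leq_trans (ltnW lt_c); rewrite leq_addr.
rewrite leq_eqVlt => /orP[/eqP e|gt]; last first.
  by do 2!case: ifP => _; rewrite ?a0 ?coef0 ?subr0.
have : (i < c %% n.+1)%N by move: lt_c; rewrite {1}(divn_eq c n.+1) -e ltn_add2l.
rewrite -{1}(inordK (ltn_pmod c (ltn0Sn n))) -e; set r := inord _ => ir.
rewrite ifN ?coef0; last by apply: contraTneq ir => ->; rewrite ltnn.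
(* Component [l] occurs here only with [i < l], and then [a 0 i] has no coefficient in degree
   [d]. *)
case: eqP => [rl|_]; last by rewrite coef0 subr0.
by rewrite alt ?subr0 // -rl.
Qed.

End LeadingClass.

(** Quotient and remainder determine a position, so each monomial placed in [M] contributes to
    exactly one position. *)
Lemma poscoef_muM E (j : 'I_n) (c : nat) :
  let t := nth 0%N (basic_nonpivots n.+1 (muA a)) j in
  let p := pivots (muA a) in
  poscoef (col j (muM E)) c =
    (t == c)%:R - \sum_(k < size p | nth 0%N p k == c) mxnat E k t.
Proof.
have divmodE (x y : nat) : (x == y) = (x %% n.+1 == y %% n.+1)%N && (y %/ n.+1 == x %/ n.+1)%N.
  apply/eqP/andP => [->|[/eqP e1 /eqP e2]]; first by rewrite !eqxx.
  by rewrite (divn_eq x n.+1) e1 -e2 -divn_eq.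
move=> t p; rewrite /poscoef mxE mxE -/t -/p coefB coef_sum inordK ?ltn_mod //.
rewrite (divmodE t c); congr (_ - _).
  by case: eqP => _; rewrite ?coefXn ?coef0.
rewrite [RHS]big_mkcond; apply: eq_bigr => k _; rewrite (divmodE _ c).
case: eqP => _; rewrite ?coef0 //= coefCM coefXn.
by case: eqP; rewrite ?mulr1 ?mulr0.
Qed.
End Syzygies.

(** * Minimal representatives of the non-pivotal classes *)

Section BasicNonpivots.
Variables (K : fieldType) (n m N : nat) (A : 'M[K]_(m, N)).
Local Notation qt := (basic_nonpivots n A).

Lemma basic_nonpivots_sub : {subset qt <= nonpivots A}.
Proof. by move=> t; rewrite mem_filter => /andP[]. Qed.

Lemma basic_nonpivots_le (c : nat) : c \in nonpivots A ->
  exists2 t, t \in qt & (t %% n = c %% n)%N /\ (t <= c)%N.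
Proof.
elim/ltn_ind: c => c IH qc.
have [ac|nac] := boolP (c \in qt); first by exists c.
move: nac; rewrite mem_filter qc andbT => /allPn[c'].
rewrite mem_filter => /andP[lt qc']; rewrite negbK => /eqP e.
have [t qt_t [et le]] := IH _ lt qc'; exists t => //.
by rewrite et e; split=> //; apply: leq_trans le (ltnW lt).
Qed.

Lemma basic_nonpivots_mod_inj : {in qt &, injective (modn^~ n)}.
Proof.
move=> t t'; rewrite !mem_filter => /andP[/allP at_ qt_] /andP[/allP at' qt'] e.
case: (ltngtP t t') => // lt.
  by move/(_ t): at'; rewrite mem_filter lt qt_ e eqxx => /(_ isT).
by move/(_ t'): at_; rewrite mem_filter lt qt' e eqxx => /(_ isT).
Qed.

Lemma basic_nonpivots_uniq : uniq qt.
Proof.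
apply: filter_uniq; apply: (sorted_uniq ltn_trans ltnn).
exact: sorted_val_filter_enum.
Qed.
End BasicNonpivots.

(** * Matrices whose columns have leading positions in distinct classes *)

Section DistinctLeadingPositions.
Variables (K : fieldType) (n m : nat) (M : 'M[{poly K}]_(n.+1, m)) (t : 'I_m -> nat).
Hypothesis Mlead : forall j, lead_pos (col j M) (t j).
Hypothesis tinj : injective (fun j => t j %% n.+1)%N.

Lemma col_inj : injective (fun j => col j M).
Proof.
move=> j j' e; apply: tinj; congr (_ %% _)%N.
by apply: lead_pos_inj (Mlead j) _; rewrite [col j M]e.
Qed.

(** The last non-zero entry of [LV (col j M)] is in row [t j %% n.+1]. These rows are distinct, so
    the largest one among the columns used in a combination receives a single non-zero term. *)
Lemma LV_free : row_free (\matrix_(j < m, i < n.+1) LV (col j M) i 0).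
Proof.
apply: inj_row_free => v vM; apply/eqP.
case: (pickP (fun j => v 0 j != 0)) => [j0 vj0|v0]; last first.
  by apply/eqP/rowP=> j; rewrite mxE; apply/eqP; rewrite -[_ == _]negbK v0.
have [j vj maxj] := arg_maxnP (P := fun j => v 0 j != 0) (fun j => t j %% n.+1)%N vj0.
pose r : 'I_n.+1 := inord (t j %% n.+1).
have rE : nat_of_ord r = (t j %% n.+1)%N by rewrite inordK ?ltn_mod.
have LVE j' i : LV (col j' M) i 0 = poscoef (col j' M) ((t j' %/ n.+1) * n.+1 + i)%N.
  by rewrite mxE poscoef_kr (lead_pos_vdegc (Mlead j')).
move/rowP/(_ r): vM; rewrite [LHS]mxE [RHS]mxE (bigD1 j) //= big1 ?addr0.
  move/eqP; rewrite mxE mulf_eq0 (negPf vj) /= LVE rE -divn_eq.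
  by case: (Mlead j) => /negPf->.
move=> j' ne; have [->|vj'] := eqVneq (v 0 j') 0; first by rewrite mul0r.
rewrite mxE LVE (Mlead j').2 ?mulr0 // {1}(divn_eq (t j') n.+1) ltn_add2l rE.
rewrite ltn_neqAle; apply/andP; split; last exact: maxj.
by apply: contra ne => /eqP/tinj->.
Qed.

Lemma mulmx_sum_col (w : 'cV[{poly K}]_m) : M *m w = \sum_j w j 0 *: col j M.
Proof.
apply/matrixP=> i k; rewrite ord1 summxE mxE; apply: eq_bigr => j _.
by rewrite !mxE mulrC.
Qed.

(** Each non-zero multiple of a column keeps the class of its leading position, so these positions
    stay distinct and the greatest cannot cancel. *)
Lemma mulmx_cV_eq0 (w : 'cV[{poly K}]_m) : M *m w = 0 -> w = 0.
Proof.
move=> Mw; apply/eqP; case: (pickP (fun j => w j 0 != 0)) => [j0 wj0|w0]; last first.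
  by apply/eqP/colP=> j; rewrite mxE; apply/eqP; rewrite -[_ == _]negbK w0.
pose T j := ((size (w j ord0)).-1 * n.+1 + t j)%N.
have [j wj maxj] := arg_maxnP (P := fun j => w j 0 != 0) T wj0.
have TM j' : w j' 0 != 0 -> lead_pos (w j' 0 *: col j' M) (T j').
  by move=> nz; apply: lead_posZ.
have := congr1 (fun h => poscoef h (T j)) Mw.
rewrite /= mulmx_sum_col poscoef_sum poscoef0 (bigD1 j) //= big1 ?addr0.
  by case: (TM j wj) => /eqP.
move=> j' ne; have [->|nz] := eqVneq (w j' 0) 0; first by rewrite scale0r poscoef0.
rewrite (TM j' nz).2 // ltn_neqAle; apply/andP; split; last exact: maxj.
apply: contra ne => /eqP e; apply/eqP/tinj.
by move/(congr1 (modn^~ n.+1)): e; rewrite /T !modnMDl.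
Qed.

(** Reduction by induction on a bound for the positions of [h]: a monomial multiple of a suitable
    column removes the top one. *)
Lemma col_generate (S : 'cV[{poly K}]_n.+1 -> Prop) :
  (forall h j p, S h -> S (h - p *: col j M)) ->
  (forall h c, S h -> lead_pos h c ->
     exists2 j, (t j = c %[mod n.+1])%N & (t j <= c)%N) ->
  forall h, S h -> exists w, h = M *m w.
Proof.
move=> SB Slead h; have [b] := poscoef_bounded h.
elim: b h => [|b IH] h hb Sh.
  by exists 0; rewrite mulmx0; apply: poscoef_inj => c; apply: hb.
have [hb0|nz] := eqVneq (poscoef h b) 0.
  by apply: IH => // c; rewrite leq_eqVlt => /predU1P[<-//|]; apply: hb.
have [j tj le] := Slead h b Sh (conj nz hb).
(* The shift by [k] moves [t j] to [b], and [x] matches the coefficients there. *)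
pose x := poscoef h b / poscoef (col j M) (t j); pose k := (b %/ n.+1 - t j %/ n.+1)%N.
have kE : (b = k * n.+1 + t j)%N.
  rewrite {1}(divn_eq b n.+1) [in RHS](divn_eq (t j) n.+1) tj addnA -mulnDl.
  by rewrite subnK // leq_div2r.
have [w hw] : exists w, h - (x%:P * 'X^k) *: col j M = M *m w.
  apply: IH (SB _ _ _ Sh) => c le_c; rewrite poscoefB -scalerA poscoefZ.
  have le_k : (k * n.+1 <= c)%N by apply: leq_trans le_c; rewrite kE leq_addr.
  rewrite poscoefXn //.
  move: le_c; rewrite leq_eqVlt => /predU1P[<-|lt].
    by rewrite {2}kE addKn /x mulfVK ?subrr //; case: (Mlead j).
  by rewrite hb // (Mlead j).2 ?mulr0 ?subr0 // ltn_subRL -kE.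
exists (w + (x%:P * 'X^k) *: delta_mx j 0).
by rewrite mulmxDr -hw -scalemxAr -colE subrK.
Qed.
End DistinctLeadingPositions.

(** * The columns of [M] as syzygies with basic leading positions *)

Section MuBasisColumns.
Variables (K : fieldType) (n : nat) (a : 'rV[{poly K}]_n.+1).
Local Notation d := (vdegr a).
Local Notation qt := (basic_nonpivots n.+1 (muA a)).
Local Notation p := (pivots (muA a)).
Variable E : 'M[K]_(d.*2.+1, n.+1 * d.+1).
Hypothesis AE : rref_of (muA a) E.

(** The index itself is not a pivot, so its coefficient stays 1; a pivot after it has coefficient 0,
    as each row of [E] vanishes before its pivot. *)
Lemma muM_lead_pos (j : 'I_n) : (j < size qt)%N ->
  lead_pos (col j (muM E)) (nth 0%N qt j).
Proof.
move=> lt; set t := nth _ _ _.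
have /mem_nonpivots[t' npt' tE] : t \in nonpivots (muA a).
  by apply: basic_nonpivots_sub (mem_nth _ lt).
split=> [|c lt_c]; rewrite poscoef_muM -/t.
  rewrite eqxx big1 ?subr0 ?oner_eq0 // => k /eqP e.
  have : t \in p by rewrite -e mem_nth.
  case/mem_pivots=> t'' pt''; rewrite tE => /val_inj e'.
  by rewrite e' pt'' in npt'.
rewrite (ltn_eqF lt_c) sub0r big1 ?oppr0 // => k /eqP e.
by rewrite tE (rref_of_pivot_gt AE) // -tE e.
Qed.

(** The column encodes the relation of [rref_of_col]: a non-pivotal column of [muA] minus its
    expansion in pivotal ones. *)
Lemma muM_syz (j : 'I_n) : (j < size qt)%N -> a *m col j (muM E) = 0.
Proof.
move=> lt; set t := nth 0%N qt j.
have /mem_nonpivots[t' npt' tE] : t \in nonpivots (muA a).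
  by apply: basic_nonpivots_sub (mem_nth _ lt).
have pN (k : 'I_(size p)) : exists c : 'I_(n.+1 * d.+1), nth 0%N p k = c.
  by have /mem_pivots[c _ ->] := mem_nth 0%N (ltn_ord k); exists c.
apply: syz_muA => [c le|i].
  rewrite poscoef_muM -/t big_pred0 => [|k]; last first.
    by have [c' ->] := pN k; apply/ltn_eqF/(leq_trans _ le).
  by rewrite subr0 tE; case: eqP => // e; move: (ltn_ord t'); rewrite e ltnNge le.
under eq_bigr do rewrite poscoef_muM -/t mulrBr.
rewrite sumrB (bigD1 t') //= tE eqxx mulr1 big1 ?addr0; last first.
  by move=> c ne; rewrite eq_sym (negPf (ne : val c != val t')) mulr0.
apply/eqP; rewrite subr_eq0; apply/eqP; rewrite (rref_of_col i t' AE).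
under [RHS]eq_bigr do rewrite mulr_sumr.
rewrite (exchange_big_dep predT) //=; apply: eq_bigr => k _.
have [c ck] := pN k; rewrite ck mxnatE.
by rewrite (big_pred1 c) 1?mulrC // => c' /=; rewrite eq_sym.
Qed.
End MuBasisColumns.

(** * The number of basic non-pivotal indices *)

Section LeadingClassCount.
Variables (K : fieldType) (n : nat) (a : 'rV[{poly K}]_n.+1) (l : 'I_n.+1).
Local Notation d := (vdegr a).
Hypotheses (al : (a 0 l)`_d != 0)
           (alt : forall r : 'I_n.+1, (r < l)%N -> (a 0 r)`_d = 0).

(** The dependence of column [c] on earlier columns, with coefficient 1 at [c] and 0 after it, is
    read back as a polynomial vector. *)
Lemma nonpivotal_syz (c : 'I_(n.+1 * d.+1)) : ~~ pivotal (muA a) c ->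
  exists2 h : 'cV[{poly K}]_n.+1, a *m h = 0 & lead_pos h c.
Proof.
rewrite negbK => /colsubP[x Ac].
pose f (c' : nat) := if (c' < c)%N then - oapp x 0 (insub c') else (c' == c)%:R.
pose h : 'cV[{poly K}]_n.+1 := \col_r \poly_(k < d.+1) f (k * n.+1 + r)%N.
have hE c' : poscoef h c' = if (c' < n.+1 * d.+1)%N then f c' else 0.
  by rewrite /poscoef mxE coef_poly inordK ?ltn_mod // -divn_eq ltn_divLR // mulnC.
exists h.
  apply: syz_muA => [c' le|i]; first by rewrite hE ltnNge le.
  under eq_bigr do rewrite hE ltn_ord.
  rewrite (bigID (fun c' : 'I__ => (c' < c)%N)) /= [X in _ + X](bigD1 c) ?ltnn //=.
  rewrite [X in _ + (_ + X)]big1 => [|c' /andP[/negPf nlt ne]]; last first.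
    by rewrite /f nlt (negPf (ne : val c' != val c)) mulr0.
  rewrite addr0 {2}/f ltnn eqxx mulr1 Ac -big_split big1 //= => c' lt.
  by rewrite /f lt valK /= mulrN addNr.
split=> [|c' lt]; rewrite hE.
  by rewrite ltn_ord /f ltnn eqxx oner_eq0.
by rewrite /f [(c' < c)%N]ltnNge (ltnW lt) /= (gtn_eqF lt) if_same.
Qed.

Lemma size_basic_nonpivots : size (basic_nonpivots n.+1 (muA a)) = n.
Proof.
set qt := basic_nonpivots _ _.
(* The residues of [qt] are shown to be a permutation of all classes except [l]. *)
rewrite -(size_map (modn^~ n.+1)) -[RHS]/(n.+1.-1) -[in RHS](size_iota 0 n.+1).
rewrite -(@size_rem _ (l : nat)) ?mem_iota ?ltn_ord //; apply/perm_size/uniq_perm.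
- rewrite map_inj_in_uniq ?basic_nonpivots_uniq //; exact: basic_nonpivots_mod_inj.
- by rewrite rem_uniq ?iota_uniq.
move=> r; rewrite mem_rem_uniq ?iota_uniq // inE mem_iota add0n /=.
apply/mapP/andP=> [[t qt_t ->]|[rl lt]].
  have /mem_nonpivots[c npc ->] := basic_nonpivots_sub qt_t.
  have [h ah hc] := nonpivotal_syz npc.
  by rewrite ltn_mod (syz_lead_class al alt ah hc).
have rl' : Ordinal lt != l by [].
have [t qt_t [e _]] := basic_nonpivots_le n.+1 (koszul_nonpivot al alt rl').
by exists t => //; rewrite e modnMDl modn_small.
Qed.
End LeadingClassCount.

(** * The first index of maximal degree, and assembly of the basis *)

Lemma vdegr_lead (K : fieldType) n (a : 'rV[{poly K}]_n) : a != 0 ->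
  exists2 l : 'I_n, (a 0 l)`_(vdegr a) != 0 &
    forall r : 'I_n, (r < l)%N -> (a 0 r)`_(vdegr a) = 0.
Proof.
move=> a0.
have [r ar] : exists r, a 0 r != 0.
  apply/existsP; apply: contraR a0 => /existsPn a0; apply/eqP/rowP=> r.
  by rewrite mxE; apply/eqP; rewrite -[_ == _]negbK a0.
have [i0 ai0] : exists i, (a 0 i)`_(vdegr a) != 0.
  have [i _ di] : {i | true & vdegr a = (size (a ord0 i)).-1}.
    apply: eq_bigmax_cond; apply/card_gt0P; by exists r.
  (* The maximum may be attained at a zero entry, which counts as degree 0; then [a] is constant and
     any non-zero entry serves. *)
  have [ai|ai] := eqVneq (a 0 i) 0; last by exists i; rewrite di -lead_coefE lead_coef_eq0.
  have d0 : vdegr a = 0%N by rewrite di ai size_poly0.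
  exists r; suff <- : (size (a ord0 r)).-1 = vdegr a by rewrite -lead_coefE lead_coef_eq0.
  apply/eqP; rewrite eqn_leq [X in _ && (X <= _)%N]d0 andbT.
  exact: (leq_bigmax (F := fun r => (size (a ord0 r)).-1)).
have [l al minl] := arg_minnP (P := fun i => (a 0 i)`_(vdegr a) != 0) (@nat_of_ord n) ai0.
exists l => // i; rewrite ltnNge => lt; apply/eqP; apply: contraNT lt; exact: minl.
Qed.

Unset Implicit Arguments.

Theorem theorem2 (K : fieldType) (n : nat) (a : 'rV[{poly K}]_n)
    (E : 'M[K]_((vdegr a).*2.+1, n * (vdegr a).+1)) :
  (1 < n)%N -> a != 0 -> rref_of (muA a) E -> mu_basis a (muM (a:=a) E).
Proof.
case: n a E => // n a E _ a0 AE.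
have [l al alt] := vdegr_lead a0.
have sz := size_basic_nonpivots al alt.
set qt := basic_nonpivots n.+1 (muA a) in sz.
have ltq (j : 'I_n) : (j < size qt)%N by rewrite sz.
have Mlead (j : 'I_n) := muM_lead_pos AE (ltq j).
have tinj : injective (fun j : 'I_n => nth 0%N qt j %% n.+1)%N.
  move=> j j' /= e; have {}e := basic_nonpivots_mod_inj (mem_nth _ (ltq j)) (mem_nth _ (ltq j')) e.
  by apply/val_inj/eqP; rewrite -(nth_uniq 0%N (ltq j) (ltq j') (basic_nonpivots_uniq _ _)) e.
split.
- exact: col_inj Mlead tinj.
- exact: LV_free Mlead tinj.
- by move=> j; apply: muM_syz.
- apply: (col_generate Mlead) => [h j x ah|h c ah hc].
    by rewrite /in_syz mulmxBr ah -scalemxAr muM_syz // scaler0 subrr.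
  suff [t /(nthP 0%N)[j lt <-] [e le]] : exists2 t, t \in qt & (t = c %[mod n.+1])%N /\ (t <= c)%N.
    by rewrite sz in lt; exists (Ordinal lt).
  (* A leading position beyond the columns of [muA] is handled by the Koszul index of its class,
     which is smaller. *)
  case: (ltnP c (n.+1 * (vdegr a).+1)) => [lt|ge].
    apply: basic_nonpivots_le; apply/mem_nonpivots; exists (Ordinal lt) => //.
    exact: (syz_nonpivotal (c := Ordinal lt) ah hc).
  have cl : inord (c %% n.+1) != l.
    apply/eqP=> e; have := syz_lead_class al alt ah hc.
    by rewrite -e inordK ?ltn_mod ?eqxx.
  have [t qt_t [e le]] := basic_nonpivots_le n.+1 (koszul_nonpivot al alt cl).
  exists t => //; rewrite e modnMDl inordK ?ltn_mod // modn_mod; split=> //.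
  apply: leq_trans le (leq_trans _ ge).
  by rewrite [(n.+1 * _)%N]mulnC mulSn addnC leq_add2r ltnW.
- exact: mulmx_cV_eq0 Mlead tinj.
Qed.
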